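(* Let $a,n\in\mathbb N$ and let $n=\sum_{i\in\mathbb N}\alpha_iU_i$ be a representation (with only finitely many nonzero $\alpha_i$) in which the integer coefficients satisfy $0\le\alpha_1<a$, $0\le\alpha_i\le a$ for all $i\ge 2$, and $\alpha_i=a$ only if $\alpha_{i-1}=0$. Then $$c_{a,n}=\sum_{i\in\mathbb N}\alpha_iU_{i-1}+\tau(n).$$
   Context: $\mathbb N=\{1,2,3,\dots\}$. For $a\in\mathbb N$ the sequence $(c_{a,n})_{n\ge 0}$ is defined by $c_{a,0}=0$, $c_{a,1}=1$, and $c_{a,n}=\min\{k<n : ak+c_{a,k}\ge n\}$ for $n\ge 2$. The generalised Lucas sequence $U=U(a,-1)$ is defined by $U_0=0$, $U_1=1$, $U_{m+1}=aU_m+U_{m-1}$ for $m\ge1$. Given the representation $n=\sum\alpha_iU_i$ as in the claim, $\tau(n)\in\{0,1\}$ is defined by: $\tau(n)=0$ if $\alpha_1=0$; $\tau(n)=1$ if $\alpha_1>1$; if $1=\alpha_1=\alpha_2=\dots=\alpha_i$ and $\alpha_{i+1}=0$, then $\tau(n)=\frac{1+(-1)^{i+1}}{2}$; if $1=\alpha_1=\dots=\alpha_i<\alpha_{i+1}$, then $\tau(n)=\frac{1+(-1)^i}{2}$. *)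

(* Defs.v *)
From mathcomp Require Import all_boot all_order all_algebra.
From mathcomp Require Import zify.
Set Implicit Arguments.
Unset Strict Implicit.
Unset Printing Implicit Defensive.

Local Open Scope nat_scope.

(* [find p (iota 0 n)] is the least [k < n] satisfying [p], because entry [k]
   of [iota 0 n] is [k]; the list argument [s] holds c_0, ..., c_(n-1). *)
Definition c_next (a : nat) (s : seq nat) : nat :=
  let n := size s in
  if n < 2 then n else find (fun k => n <= a * k + nth 0 s k) (iota 0 n).

Fixpoint c_prefix (a n : nat) : seq nat :=
  if n is m.+1 then rcons (c_prefix a m) (c_next a (c_prefix a m)) else [::].

Definition c (a n : nat) : nat := c_next a (c_prefix a n).

Lemma size_c_prefix a n : size (c_prefix a n) = n.
Proof. by elim: n => //= n IHn; rewrite size_rcons IHn. Qed.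

Lemma nth_c_prefix a n k : k < n -> nth 0 (c_prefix a n) k = c a k.
Proof.
elim: n => // n IHn; rewrite ltnS leq_eqVlt /= nth_rcons size_c_prefix.
by case/predU1P=> [->|lt_kn]; rewrite ?ltnn ?eqxx // lt_kn IHn.
Qed.

Lemma c0 a : c a 0 = 0. Proof. by []. Qed.

Lemma c1 a : c a 1 = 1. Proof. by []. Qed.

Lemma cE a n : 2 <= n ->
  c a n = find (fun k => n <= a * k + c a k) (iota 0 n).
Proof.
move=> n2; rewrite /c /c_next size_c_prefix ltnNge n2 /=.
apply: eq_in_find => k; rewrite mem_iota => /andP[_ ltkn].
by rewrite nth_c_prefix.
Qed.

Lemma cP a n : 0 < a -> 2 <= n ->
  [/\ c a n < n, n <= a * c a n + c a (c a n)
    & forall k, k < n -> n <= a * k + c a k -> c a n <= k].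
Proof.
move=> a0; elim/ltn_ind: n => n IHn n2.
have cpos m : 0 < m -> m < n -> 0 < c a m.
  case: m => [//|[//|m]] _ ltmn.
  have [_ + _] := IHn _ ltmn isT.
  by case: (c a m.+2) => //; rewrite muln0 c0.
have hasP : has (fun k => n <= a * k + c a k) (iota 0 n).
  apply/hasP; exists n.-1; first by rewrite mem_iota; lia.
  have := cpos n.-1; nia.
have ltcn : c a n < n by rewrite cE // -[X in _ < X](size_iota 0) -has_find.
split=> //.
- have := nth_find 0 hasP; rewrite -cE // nth_iota //.
- move=> k ltkn leP; rewrite leqNgt; apply/negP; rewrite {1}cE //.
  by move/(before_find 0); rewrite nth_iota // add0n leP.
Qed.

Fixpoint U (a m : nat) : nat :=
  match m with
  | 0 => 0
  | 1 => 1
  | (m'.+1 as p).+1 => a * U a p + U a m'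
  end.

(* The length of the maximal run alpha_1 = ... = alpha_i = 1, where [N] is any
   bound such that alpha_j = 0 for all j > N. *)
Definition ones_run (N : nat) (alpha : nat -> nat) : nat :=
  find (fun j => alpha j.+1 != 1) (iota 0 N.+1).

(* tau of the integer represented by [alpha]; both integer divisions are
   exact. [alpha 0] is never used. *)
Definition tau (N : nat) (alpha : nat -> nat) : int :=
  (if alpha 1%N == 0%N then 0
   else if (1 < alpha 1)%N then 1
   else let i := ones_run N alpha in
     if alpha i.+1 == 0%N then ((1 + (-1) ^+ i.+1) %/ 2)%Z
     else ((1 + (-1) ^+ i) %/ 2)%Z)%R.

Lemma ones_runE N alpha i : (forall j, N < j -> alpha j = 0) ->
  (forall j, 1 <= j <= i -> alpha j = 1) -> alpha i.+1 != 1 ->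
  ones_run N alpha = i.
Proof.
move=> supp ones ne1; have leiN : i <= N.
  rewrite leqNgt; apply/negP => ltNi.
  by have := supp _ ltNi; rewrite ones //; lia.
have hasP : has (fun j => alpha j.+1 != 1) (iota 0 N.+1).
  by apply/hasP; exists i; rewrite // mem_iota.
have ltrN : ones_run N alpha < N.+1.
  by rewrite -[X in _ < X](size_iota 0) -has_find.
have := nth_find 0 hasP; rewrite -/(ones_run _ _) nth_iota // add0n => ne1r.
case: (ltngtP (ones_run N alpha) i) => // [ltri|ltir].
- by move: ne1r; rewrite ones // ltri.
- by have := before_find 0 ltir; rewrite nth_iota ?ltnS // add0n ne1.
Qed.

Lemma tau_eq0 N alpha : alpha 1 = 0 -> tau N alpha = 0%R.
Proof. by rewrite /tau => ->. Qed.

Lemma tau_gt1 N alpha : 1 < alpha 1 -> tau N alpha = 1%R.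
Proof. by rewrite /tau; case: (alpha 1) => [|[|k]]. Qed.

Lemma tau_run0 N alpha i : (forall j, N < j -> alpha j = 0) ->
  1 <= i -> (forall j, 1 <= j <= i -> alpha j = 1) -> alpha i.+1 = 0 ->
  tau N alpha = ((1 + (-1) ^+ i.+1) %/ 2)%Z%R.
Proof.
move=> supp i1 ones e; rewrite /tau (ones 1) //=.
by rewrite (@ones_runE N alpha i) ?e.
Qed.

Lemma tau_run_gt1 N alpha i : (forall j, N < j -> alpha j = 0) ->
  1 <= i -> (forall j, 1 <= j <= i -> alpha j = 1) -> 1 < alpha i.+1 ->
  tau N alpha = ((1 + (-1) ^+ i) %/ 2)%Z%R.
Proof.
move=> supp i1 ones e; rewrite /tau (ones 1) //=.
by rewrite (@ones_runE N alpha i) //; case: (alpha i.+1) e => [|[|k]].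
Qed.

(* Main.v *)
Require Import Defs.
From mathcomp Require Import all_boot all_order all_algebra.
From mathcomp Require Import zify ring lra realalg.

(** Let [mu] be the positive root of [mu^2 + a mu = 1] and [theta = mu / (1 + mu)].
    The recursion for [c] gives [c n = floor (n mu + 1 - theta)] by induction: with
    strict bounds on both sides, the lower bound at [c n] yields the upper bound
    at [n], and the upper bound at [c n - 1] the lower bound at [n].
    Since [mu U_i - U_(i-1) = mu (-mu)^(i-1)], the number [n mu - sum alpha_i U_(i-1)] is the alternating expansion
    [x_1 = sum alpha_i mu (-mu)^(i-1)], so the theorem says that [tau n = 1]
    exactly when [x_1 > theta].  The tails of the expansion satisfy
    [x_j = mu (alpha_j - x_(j+1))] and stay in the interval [(-mu, 1)], so a digit
    [0] puts [x_j] below [theta] and a digit at least [2] puts it above.  As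
    [theta] is the fixed point of [x |-> mu (1 - x)], a digit [1] reverses the
    comparison, whence the parity of the initial run of ones in [tau]. *)

Set Implicit Arguments.
Unset Strict Implicit.
Unset Printing Implicit Defensive.

Import Order.TTheory GRing.Theory Num.Theory.
Local Open Scope ring_scope.

(** Later used in the form [mu <= (1 + mu)^-1], that is, [mu <= 1 - theta]. *)
Lemma sqr_mu_add_mu_le1 (R : realFieldType) (mu : R) (a : nat) :
  (0 < a)%N -> 0 < mu -> mu ^+ 2 + a%:R * mu = 1 -> mu ^+ 2 + mu <= 1.
Proof.
by move=> a0 /ltW mu0 <-; rewrite lerD2l ler_peMl // ler1n.
Qed.

Lemma c_floor (R : realFieldType) (mu : R) (a n : nat) :
  (0 < a)%N -> 0 < mu -> mu ^+ 2 + a%:R * mu = 1 ->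
  (c a n)%:R < n%:R * mu + (1 + mu)^-1 < (c a n)%:R + 1.
Proof.
move=> a0 mu0 Emu; have le1 := sqr_mu_add_mu_le1 a0 mu0 Emu.
set b := (1 + mu)^-1.
have mu10 : 1 + mu != 0 by lra.
have Eb : b * (1 + mu) = 1 by rewrite mulVf.
(* Here [b = 1 - theta]. As [mu] is the inverse of [a + mu], multiplying by [mu] turns bounds on [m]
   into bounds on [m * mu]. *)
have scale t : (t * (a%:R + mu) + b) * mu = t + 1 - b.
  transitivity (t * (mu ^+ 2 + a%:R * mu) + b * (1 + mu) - b); first by ring.
  by rewrite Emu Eb mulr1.
have b0 : 0 < b by rewrite invr_gt0; lra.
have b1 : b < 1 by nra.
have mu1 : mu < 1 by nra.
elim/ltn_ind: n => -[|[|n]] IHn; first by rewrite c0; lra.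
  rewrite c1; nra.
set m := n.+2 in IHn *.
have [ltkm lemk mink] := @cP a m a0 isT.
set k := c a m in ltkm lemk mink *.
have k0 : (0 < k)%N by case: k lemk {ltkm mink} => //; rewrite muln0 c0.
have [/andP[IHk _] /andP[_ IHk1]] := (IHn _ ltkm, IHn k.-1 ltac:(lia)).
(* Minimality of [k] excludes [k.-1], a true predecessor by [k0]; integrality gives the extra 1 that
   matches the upper bound [IHk1]. *)
have {mink} ltfm : (a * k.-1 + (c a k.-1).+1 <= m)%N.
  by have := mink k.-1; lia.
move: lemk ltfm; rewrite -(ler_nat R) -(ler_nat R (_ + _)).
rewrite !natrD !natrM -[(c a k.-1).+1]addn1 natrD.
have Ek1 : (k.-1)%:R = k%:R - 1 :> R by rewrite -subn1 natrB.
rewrite {}Ek1 in IHk1 *.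
move=> lemk ltfm; apply/andP; split.
  have : ((k%:R - 1) * (a%:R + mu) + b) * mu < m%:R * mu by rewrite ltr_pM2r //; lra.
  rewrite scale; lra.
have : m%:R * mu < (k%:R * (a%:R + mu) + b) * mu by rewrite ltr_pM2r //; lra.
rewrite scale; lra.
Qed.

(** The roots of x^2 = a x + 1 are 1/mu and -mu; the left side cancels the contribution of 1/mu. *)
Lemma U_mu (R : realFieldType) (mu : R) (a i : nat) :
  mu ^+ 2 + a%:R * mu = 1 ->
  (U a i.+1)%:R * mu - (U a i)%:R = mu * (- mu) ^+ i.
Proof.
move=> Emu; elim: i => [|i IHi]; first by rewrite /= expr0; ring.
have -> : U a i.+2 = (a * U a i.+1 + U a i)%N by [].
rewrite natrD natrM exprS mulrCA -IHi.
have -> : (a%:R * (U a i.+1)%:R + (U a i)%:R) * mu - (U a i.+1)%:R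
  = (U a i.+1)%:R * (a%:R * mu - 1) + (U a i)%:R * mu by ring.
have -> : a%:R * mu = 1 - mu ^+ 2 by lra.
ring.
Qed.

(** The tail x_j, rescaled so that its first digit always has weight [mu]. *)
Definition alt_tail (R : realFieldType) (mu : R) (alpha : nat -> nat)
    (N j : nat) : R :=
  \sum_(j <= i < N.+1) (alpha i)%:R * mu * (- mu) ^+ (i - j).

Lemma alt_tail_rec (R : realFieldType) (mu : R) (alpha : nat -> nat)
    (N j : nat) : (forall i, (N < i)%N -> alpha i = 0%N) ->
  alt_tail mu alpha N j = mu * ((alpha j)%:R - alt_tail mu alpha N j.+1).
Proof.
move=> fin; rewrite /alt_tail; have [leNj|ltjN] := ltnP N j.
  by rewrite !big_geq ?(leqW leNj) // fin // subrr mulr0.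
rewrite big_ltn // subnn expr0 mulr1 mulrBr mulrC; congr (_ + _).
rewrite -mulrN -sumrN big_distrr /=.
apply: eq_big_nat => i /andP[ltji _].
by rewrite -[(i - j)%N]prednK ?subn_gt0 // exprS -subnS; ring.
Qed.

(** For 0 <= d <= a the map x -> mu (d - x) preserves the interval, since -mu = mu (0 - 1) and 1 =
    mu (a + mu). *)
Lemma alt_tail_bounds (R : realFieldType) (mu : R) (a : nat)
    (alpha : nat -> nat) (N j : nat) :
  0 < mu -> mu ^+ 2 + a%:R * mu = 1 ->
  (forall i, (N < i)%N -> alpha i = 0%N) ->
  (forall i, (0 < i)%N -> (alpha i <= a)%N) ->
  (0 < j)%N -> - mu < alt_tail mu alpha N j < 1.
Proof.
move=> mu0 Emu fin le_a.
(* The induction runs downwards in [j], starting from the empty tail beyond [N]. *)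
move: {2}(N.+1 - j)%N (leqnn (N.+1 - j)) => d.
elim: d j => [|d IHd] j led j0; first by rewrite /alt_tail big_geq; lra || lia.
have /andP[lo hi] := IHd j.+1 ltac:(lia) isT.
rewrite (alt_tail_rec _ _ fin).
have := le_a j j0; rewrite -(ler_nat R) => lea.
have := ler0n R (alpha j) => ge0.
move: (alt_tail _ _ _ _) lo hi => x lo hi; apply/andP; split; first nra.
have : mu * ((alpha j)%:R - x) < mu * (mu + a%:R) by rewrite ltr_pM2l //; lra.
by rewrite [mu * (mu + _)]mulrDr -expr2 [mu * a%:R]mulrC Emu.
Qed.

(** After division by [mu], the quantity alpha_j - x_(j+1) is compared with 1/(1 + mu): it exceeds 1
    for a digit at least 2 and is below [mu] for a digit 0. *)
Lemma alt_tail_digit_neq1 (R : realFieldType) (mu : R) (a : nat)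
    (alpha : nat -> nat) (N j : nat) :
  (0 < a)%N -> 0 < mu -> mu ^+ 2 + a%:R * mu = 1 ->
  (forall i, (N < i)%N -> alpha i = 0%N) ->
  (forall i, (0 < i)%N -> (alpha i <= a)%N) ->
  (0 < j)%N -> alpha j != 1%N ->
  if (1 < alpha j)%N then mu / (1 + mu) < alt_tail mu alpha N j
  else alt_tail mu alpha N j < mu / (1 + mu).
Proof.
move=> a0 mu0 Emu fin le_a j0 ne1; have le1 := sqr_mu_add_mu_le1 a0 mu0 Emu.
have /andP[lo hi] := @alt_tail_bounds R mu a alpha N j.+1 mu0 Emu fin le_a isT.
rewrite (alt_tail_rec _ _ fin) ltr_pM2l // ltr_pM2l //.
have b1 : (1 + mu)^-1 < 1 by rewrite invf_lt1; lra.
case: ifP => lt1; first by move: lt1; rewrite -(ler_nat R); lra.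
have -> : alpha j = 0%N by move: ne1 lt1; case: (alpha j) => [|[]].
have : mu <= (1 + mu)^-1 by rewrite -[_^-1]mul1r ler_pdivlMr; nra.
lra.
Qed.

Lemma alt_tail_ones (R : realFieldType) (mu : R)
    (alpha : nat -> nat) (N j r : nat) : 0 < mu ->
  (forall i, (N < i)%N -> alpha i = 0%N) ->
  (forall i, (j <= i < j + r)%N -> alpha i = 1%N) ->
  alt_tail mu alpha N j - mu / (1 + mu)
  = (- mu) ^+ r * (alt_tail mu alpha N (j + r) - mu / (1 + mu)).
Proof.
move=> mu0 fin; elim: r => [|r IHr] ones; first by rewrite expr0 mul1r addn0.
rewrite IHr; last by move=> i Hi; apply: ones; lia.
rewrite (alt_tail_rec _ _ fin) ones ?addnS; last by lia.
by rewrite exprS; field; lra.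
Qed.

Lemma tau_alt_tail (R : realFieldType) (mu : R) (a : nat)
    (alpha : nat -> nat) (N : nat) :
  (0 < a)%N -> 0 < mu -> mu ^+ 2 + a%:R * mu = 1 ->
  (forall i, (N < i)%N -> alpha i = 0%N) ->
  (forall i, (0 < i)%N -> (alpha i <= a)%N) ->
  exists2 t : bool, tau N alpha = (t : nat)%:Z &
    if t then mu / (1 + mu) < alt_tail mu alpha N 1
    else alt_tail mu alpha N 1 < mu / (1 + mu).
Proof.
move=> a0 mu0 Emu fin le_a.
have ex : exists r, alpha r.+1 != 1%N by exists N; rewrite fin.
case: (ex_minnP ex) => r ne1 minr.
have ones i : (1 <= i <= r)%N -> alpha i = 1%N.
  case: i => // i /andP[_ ltir]; apply/eqP; apply: contraLR ltir.
  by rewrite -leqNgt; apply: minr.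
have [r0|r0] := posnP r.
  rewrite r0 in ne1; exists (1 < alpha 1)%N.
    2: exact: (alt_tail_digit_neq1 a0 mu0 Emu fin le_a (ltn0Sn 0) ne1).
  case: ltnP => [/tau_gt1-> //|le1].
  by rewrite tau_eq0 //; move: ne1 le1; case: (alpha 1) => [|[]].
(* The digit after the run decides the comparison at [r.+1]; each of the [r] ones flips it. *)
exists (odd r (+) (1 < alpha r.+1))%N.
  case: ltnP => [gt1|le1].
    rewrite (tau_run_gt1 fin r0 ones gt1) -signr_odd addbT.
    by case: (odd r).
  have e0 : alpha r.+1 = 0%N by move: ne1 le1; case: (alpha _) => [|[]].
  by rewrite (tau_run0 fin r0 ones e0) -signr_odd /= addbF; case: (odd r).
have := @alt_tail_ones R mu alpha N 1 r mu0 fin ones.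
have := @alt_tail_digit_neq1 R mu a alpha N r.+1 a0 mu0 Emu fin le_a isT ne1.
have mur0 : 0 < mu ^+ r by rewrite exprn_gt0.
rewrite add1n exprNn -signr_odd.
case: ifP => _ H E; case: (odd r) E => /= E; rewrite -subr_gt0 in H;
  rewrite -subr_gt0; have := mulr_gt0 mur0 H;
  rewrite ?expr1 ?expr0 in E; lra.
Qed.

Lemma repr_mu (R : realFieldType) (mu : R) (a : nat)
    (alpha : nat -> nat) (N : nat) : mu ^+ 2 + a%:R * mu = 1 ->
  (\sum_(1 <= i < N.+1) alpha i * U a i)%:R * mu
  = (\sum_(1 <= i < N.+1) alpha i * U a i.-1)%:R + alt_tail mu alpha N 1.
Proof.
move=> Emu; rewrite !natr_sum mulr_suml -big_split.
apply: eq_big_nat => -[//|i] _ /=.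
rewrite subn1 -mulrA -(U_mu i Emu) !natrM; ring.
Qed.

Lemma mu_exists (R : rcfType) (a : nat) :
  {mu : R | 0 < mu & mu ^+ 2 + a%:R * mu = 1}.
Proof.
set s := Num.sqrt (a%:R ^+ 2 + 4 : R).
have a0 := ler0n R a.
have Es : s ^+ 2 = a%:R ^+ 2 + 4 by rewrite sqr_sqrtr //; nra.
have s0 : 0 <= s := sqrtr_ge0 _.
exists ((s - a%:R) / 2); first nra.
transitivity ((s ^+ 2 - a%:R ^+ 2) / 4); first by field.
by rewrite Es; field.
Qed.

(** With S the shifted sum, n mu = S + x_1, so c_n = floor(S + x_1 + 1 - theta). The bounds on x_1
    leave only S and S + 1, and the sign of x_1 - theta selects one. *)
Lemma c_repr (R : realFieldType) (mu : R) (a : nat)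
    (alpha : nat -> nat) (N : nat) :
  (0 < a)%N -> 0 < mu -> mu ^+ 2 + a%:R * mu = 1 ->
  (forall i, (N < i)%N -> alpha i = 0%N) ->
  (forall i, (0 < i)%N -> (alpha i <= a)%N) ->
  Posz (c a (\sum_(1 <= i < N.+1) alpha i * U a i)) =
    Posz (\sum_(1 <= i < N.+1) alpha i * U a i.-1) + tau N alpha.
Proof.
move=> a0 mu0 Emu fin le_a; have le1 := sqr_mu_add_mu_le1 a0 mu0 Emu.
have [t -> Ht] := tau_alt_tail a0 mu0 Emu fin le_a.
have /andP[lo hi] := @alt_tail_bounds _ mu a alpha N 1 mu0 Emu fin le_a isT.
have := c_floor (\sum_(1 <= i < N.+1) alpha i * U a i) a0 mu0 Emu.
rewrite (repr_mu _ _ Emu).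
move: (c a _) => m.
move: (alt_tail _ _ _ _) lo hi Ht => x lo hi Ht.
move: (\sum_(_ <= _ < _) _)%N => S.
have Eb : mu / (1 + mu) = 1 - (1 + mu)^-1 by field; lra.
rewrite {}Eb in Ht.
have b1 : (1 + mu)^-1 < 1 by rewrite invf_lt1; lra.
have bmu : mu <= (1 + mu)^-1 by rewrite -[_^-1]mul1r ler_pdivlMr; nra.
move=> /andP[c_lo c_hi].
have lt1 : (m < S + t + 1)%N.
  by rewrite -(ltr_nat R) !natrD; case: t Ht => /= Ht; lra.
have lt2 : (S + t < m + 1)%N.
  by rewrite -(ltr_nat R) !natrD; case: t Ht {lt1} => /= Ht; lra.
by rewrite -PoszD; congr Posz; lia.
Qed.

Theorem theorem1p5 (a n : nat) (alpha : nat -> nat) (N : nat)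
  (a_gt0 : (0 < a)%N) (n_gt0 : (0 < n)%N)
  (alpha_fin : forall i : nat, (N < i)%N -> alpha i = 0%N)
  (n_repr : n = (\sum_(1 <= i < N.+1) alpha i * U a i)%N)
  (alpha1_lt : (alpha 1%N < a)%N)
  (alpha_le : forall i : nat, (2 <= i)%N -> (alpha i <= a)%N)
  (alpha_a : forall i : nat, (2 <= i)%N -> alpha i = a -> alpha i.-1 = 0%N) :
  Posz (c a n) = (Posz (\sum_(1 <= i < N.+1) alpha i * U a i.-1)%N
                  + tau N alpha)%R.
Proof.
have [mu mu0 Emu] := mu_exists realalg a.
rewrite {1}n_repr; apply: (c_repr a_gt0 mu0 Emu alpha_fin).
by case=> [|[|i]] // _; [apply: ltnW | apply: alpha_le].
Qed.
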